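(* Let $r\ge 2$, let $\Delta$ be the root system of type $B_r$, realized in $V=\mathbb{R}^r$ (standard inner product, orthonormal basis $e_1,\dots,e_r$) by $\Delta_+^\vee=\{e_i\pm e_j\mid 1\le i<j\le r\}\cup\{2e_j\mid 1\le j\le r\}$ and $\Psi^\vee=\{\alpha_1^\vee=e_1-e_2,\dots,\alpha_{r-1}^\vee=e_{r-1}-e_r,\ \alpha_r^\vee=2e_r\}$, and let $I=\{2,\dots,r\}$, so that $\Delta^{*\vee}=\{e_1\pm e_j\mid 2\le j\le r\}\cup\{2e_1\}$. For $2\le i\le r$ write $t_{\pm i}$ for the variable $t_\alpha$ with $\alpha^\vee=e_1\pm e_i$, and $t_1$ for the variable $t_\alpha$ with $\alpha^\vee=2e_1$. Let $\mathbf{y}=y_1\alpha_1^\vee+\cdots+y_r\alpha_r^\vee$ with $y_j\in\mathbb{R}$, and $\lambda=m_2\lambda_2+\cdots+m_r\lambda_r\in P_I$ with $m_i\in\mathbb{Z}$. Put $m_{j,k}=m_j+\cdots+m_k$ if $j\le k$ and $m_{j,k}=0$ otherwise. Then the generating function $F(\mathbf{t}_I,\mathbf{y},\lambda;I;\Delta)$ equals, as a meromorphic function of $(t_1,(t_{\pm i})_{2\le i\le r})$, \begin{align*} &\sum_{j=2}^{r}\ \prod_{2\le i<j}\frac{t_{-i}}{t_{-i}-t_{-j}+2\pi\sqrt{-1}\,m_{i,j-1}}\prod_{j<i\le r}\frac{t_{-i}}{t_{-i}-t_{-j}-2\pi\sqrt{-1}\,m_{j,i-1}}\\ &\quad\times\prod_{2\le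 i\le j}\frac{t_{+i}}{t_{+i}-t_{-j}-2\pi\sqrt{-1}(m_{i,j-1}+2m_{j,r-1}+m_r)}\\ &\quad\times\prod_{j<i\le r}\frac{t_{+i}}{t_{+i}-t_{-j}-2\pi\sqrt{-1}(m_{j,i-1}+2m_{i,r-1}+m_r)}\\ &\quad\times\frac{t_1}{t_1-2t_{-j}-2\pi\sqrt{-1}(2m_{j,r-1}+m_r)}\\ &\quad\times\exp\Bigl(2\pi\sqrt{-1}\Bigl(\sum_{i=2}^{j-1}m_i(y_i-y_1)+\sum_{i=j}^{r}m_iy_i\Bigr)\Bigr)\frac{t_{-j}\exp(t_{-j}\{y_1\})}{e^{t_{-j}}-1}\\ &+\sum_{j=2}^{r}\ \prod_{2\le i\le j}\frac{t_{-i}}{t_{-i}-t_{+j}+2\pi\sqrt{-1}(m_{i,j-1}+2m_{j,r-1}+m_r)}\\ &\quad\times\prod_{j<i\le r}\frac{t_{-i}}{t_{-i}-t_{+j}+2\pi\sqrt{-1}(m_{j,i-1}+2m_{i,r-1}+m_r)}\\ &\quad\times\prod_{2\le i<j}\frac{t_{+i}}{t_{+i}-t_{+j}-2\pi\sqrt{-1}\,m_{i,j-1}}\prod_{j<i\le r}\frac{t_{+i}}{t_{+i}-t_{+j}+2\pi\sqrt{-1}\,m_{j,i-1}}\\ &\quad\times\frac{t_1}{t_1-2t_{+j}+2\pi\sqrt{-1}(2m_{j,r-1}+m_r)}\\ &\quad\times\exp\Bigl(2\pi\sqrt{-1}\Bigl(\sum_{i=2}^{j-1}m_i(y_i-y_1)+\sum_{i=j}^{r-1}m_i(y_i-2y_1)+m_r(y_r-y_1)\Bigr)\Bigr)\frac{t_{+j}\exp(t_{+j}\{y_1\})}{e^{t_{+j}}-1}\\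 &+\prod_{2\le i\le r}\frac{t_{-i}}{t_{-i}-\frac12t_1+\pi\sqrt{-1}(2m_{i,r-1}+m_r)}\prod_{2\le i\le r}\frac{t_{+i}}{t_{+i}-\frac12t_1-\pi\sqrt{-1}(2m_{i,r-1}+m_r)}\\ &\quad\times\frac12\Biggl(\exp\Bigl(2\pi\sqrt{-1}\Bigl(\sum_{i=2}^{r-1}m_i(y_i-y_1)+m_r\bigl(y_r-\tfrac12y_1\bigr)\Bigr)\Bigr)\frac{t_1\exp(t_1\{\frac12y_1\})}{e^{t_1}-1}\\ &\qquad+\exp\Bigl(2\pi\sqrt{-1}\Bigl(\sum_{i=2}^{r-1}m_i(y_i-y_1)+m_r\bigl(y_r-\tfrac12(y_1+1)\bigr)\Bigr)\Bigr)\frac{t_1\exp(t_1\{\frac12(y_1+1)\})}{e^{t_1}-1}\Biggr), \end{align*} where $\{\cdot\}$ denotes the fractional part of a real number.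
   Context: Let $\Delta$ be a reduced root system of rank $r$ in a real inner product space $V$ with fundamental system $\Psi=\{\alpha_1,\dots,\alpha_r\}$, positive roots $\Delta_+$, coroots $\alpha^\vee$, coroot lattice $Q^\vee=\bigoplus_i\mathbb{Z}\alpha_i^\vee$, and fundamental weights $\lambda_j$ defined by $\langle\alpha_i^\vee,\lambda_j\rangle=\delta_{ij}$. For a set $A$ of roots, $A^\vee$ is the set of corresponding coroots. For $I\subset\{1,\dots,r\}$ put $\Psi_I=\{\alpha_i\mid i\in I\}$, $\Delta_I=\Delta\cap\mathrm{span}(\Psi_I)$, $\Delta_{I+}=\Delta_I\cap\Delta_+$, $P_I=\bigoplus_{i\in I}\mathbb{Z}\lambda_i$, $\Delta^*=\Delta_+\setminus\Delta_{I+}$, $d=|I^c|$. Let $\mathscr{V}_I$ be the set of all bases of $V$ of the form $\mathbf{V}=\mathbf{V}_I\cup\Psi_I$ with $\mathbf{V}_I\subset\Delta^*$, $|\mathbf{V}_I|=d$. For $\mathbf{V}\in\mathscr{V}_I$ let $L(\mathbf{V}^\vee)=\bigoplus_{\beta\in\mathbf{V}}\mathbb{Z}\beta^\vee\subset Q^\vee$, let $\{\mu^{\mathbf{V}}_\gamma\}_{\gamma\in\mathbf{V}}$ be the basis of $V$ dual to $\mathbf{V}^\vee$, and put $$p_{\mathbf{V}_I^\perp}(v)=v-\sum_{\gamma\in\mathbf{V}_I}\mu^{\mathbf{V}}_\gamma\langle\gamma^\vee,v\rangle\qquad(v\in V).$$ Fix $\phi\in V$ not lying in any hyperplane spanned by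 $r-1$ linearly independent coroots; in the present setting $\phi$ is chosen with $\langle\phi,\lambda_1\rangle>0$. For $\mathbf{y}\in V$, $\beta\in\mathbf{V}$, set $\{\mathbf{y}\}_{\mathbf{V},\beta}=\{\langle\mathbf{y},\mu^{\mathbf{V}}_\beta\rangle\}$ if $\langle\phi,\mu^{\mathbf{V}}_\beta\rangle>0$ and $\{\mathbf{y}\}_{\mathbf{V},\beta}=1-\{-\langle\mathbf{y},\mu^{\mathbf{V}}_\beta\rangle\}$ if $\langle\phi,\mu^{\mathbf{V}}_\beta\rangle<0$, where $\{\cdot\}$ on the right is the usual fractional part. For $\mathbf{t}_I=(t_\alpha)_{\alpha\in\Delta^*}$ complex variables and $\lambda\in P_I$ the generating function is \begin{align*} F(\mathbf{t}_I,\mathbf{y},\lambda;I;\Delta)=\sum_{\mathbf{V}\in\mathscr{V}_I}&\Bigl(\prod_{\gamma\in\Delta^*\setminus\mathbf{V}_I}\frac{t_\gamma}{t_\gamma-\sum_{\beta\in\mathbf{V}_I}t_\beta\langle\gamma^\vee,\mu^{\mathbf{V}}_\beta\rangle-2\pi\sqrt{-1}\langle\gamma^\vee,p_{\mathbf{V}_I^\perp}(\lambda)\rangle}\Bigr)\\ &\times\frac{1}{|Q^\vee/L(\mathbf{V}^\vee)|}\sum_{q\in Q^\vee/L(\mathbf{V}^\vee)}\exp\bigl(2\pi\sqrt{-1}\langle\mathbf{y}+q,p_{\mathbf{V}_I^\perp}(\lambda)\rangle\bigr)\prod_{\beta\in\mathbf{V}_I}\frac{t_\beta\exp(t_\beta\{\mathbf{y}+q\}_{\mathbf{V},\beta})}{e^{t_\beta}-1}.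 \end{align*} Empty sums are $0$ and empty products are $1$. *)

(* Defs.v *)
From HB Require Import structures.
From mathcomp Require Import all_boot all_order all_algebra.
From mathcomp Require Import finmap.
From mathcomp Require Import all_classical all_reals all_analysis.
From mathcomp Require Export complex.

Set Implicit Arguments.
Unset Strict Implicit.
Unset Printing Implicit Defensive.

Import Order.TTheory GRing.Theory Num.Theory.

Local Open Scope classical_set_scope.
Local Open Scope fset_scope.
Local Open Scope complex_scope.
Local Open Scope ring_scope.

Section Analysis.
Variable R : realType.

Definition cexp (z : R[i]) : R[i] :=
  (expR (complex.Re z))%:C * (cos (complex.Im z) +i* sin (complex.Im z)).

Definition twopii : R[i] := 2 * (pi : R)%:C * 'i%C.

Definition fractional (x : R) : R := x - (Num.floor x)%:~R.

End Analysis.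

Arguments twopii {R}.

Section GeneratingFunction.
Variables (R : realType) (n : nat).
Notation E := 'rV[R]_n.

Definition dot (u v : E) : R := \sum_k u 0 k * v 0 k.

Definition coroot (a : E) : E := (2 / dot a a) *: a.

(* [coroot_lattice S] is the Z-span of the coroots of the elements of S: it is
   Q^\vee when S is the fundamental system, and L(V^\vee) when S = V. *)
Definition coroot_lattice (S : {fset E}) : set E :=
  [set v | exists c : E -> int, v = \sum_(b <- S) (c b)%:~R *: coroot b].

(* The quotient Q^\vee / L(B^\vee), as a finite set of cosets. *)
Definition coroot_quotient (Psi B : {fset E}) : {fset set E} :=
  fset_set [set C | exists2 q, coroot_lattice Psi q
                             & C = [set q + l | l in coroot_lattice B]].

(* The element mu^B_g of the basis dual to B^\vee. *)
Definition dual_vector (B : {fset E}) (g : E) : E :=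
  xget 0 [set mu | forall b, b \in B -> dot (coroot b) mu = (b == g)%:R].

Definition fundamental_weight (alpha : 'I_n -> E) (j : 'I_n) : E :=
  xget 0 [set l | forall i, dot (coroot (alpha i)) l = (i == j)%:R].

(* Root data: all roots Delta, positive roots Deltap, simple roots alpha. *)
Variables (Delta Deltap : {fset E}) (alpha : 'I_n -> E) (I : {set 'I_n}).

(* phi lies in no hyperplane spanned by n - 1 linearly independent coroots. *)
Definition generic_vector (phi : E) : Prop :=
  forall s : seq E, {subset s <= Delta} -> size s = n.-1 ->
    free (map coroot s) -> phi \notin <<map coroot s>>%VS.

Definition Psi_ : {fset E} := [fset alpha i | i in 'I_n].
Definition PsiI : {fset E} := [fset alpha i | i in I].
Definition DeltaI : {fset E} :=
  [fset a in Delta | a \in <<enum_fset PsiI>>%VS].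
Definition Dstar : {fset E} := Deltap `\` (DeltaI `&` Deltap).

Definition basesI : {fset {fset E}} :=
  [fset W `|` PsiI | W in fpowerset Dstar &
     (#|` W | == #|~: I|) && basis_of fullv (enum_fset (W `|` PsiI))].

(* The part V_I of V = V_I \cup Psi_I; note that Psi_I is disjoint from
   Delta^*. *)
Definition partI (B : {fset E}) : {fset E} := B `&` Dstar.

Definition projI (B : {fset E}) (v : E) : E :=
  v - \sum_(g <- partI B) dot (coroot g) v *: dual_vector B g.

Variable phi : E.

(* dot phi (dual_vector B b) is not zero when phi is a generic vector. *)
Definition frac_part (B : {fset E}) (b y : E) : R :=
  if 0 < dot phi (dual_vector B b) then fractional (dot y (dual_vector B b))
  else 1 - fractional (- dot y (dual_vector B b)).

Variable (t : E -> R[i]) (y lambda : E).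

Definition root_denominator (B : {fset E}) (g : E) : R[i] :=
  t g - \sum_(b <- partI B) t b * (dot (coroot g) (dual_vector B b))%:C
  - twopii * (dot (coroot g) (projI B lambda))%:C.

(* The summand over q in Q^\vee / L(B^\vee) only depends on the coset of q
   when lambda is in P_I, so it is evaluated at an arbitrary element of the
   coset. *)
Definition generating_function : R[i] :=
  \sum_(B <- basesI)
    (\prod_(g <- Dstar `\` partI B) (t g / root_denominator B g))
    * (#|` coroot_quotient Psi_ B |%:R)^-1
    * \sum_(C <- coroot_quotient Psi_ B)
        let q := xget 0 C in
        cexp (twopii * (dot (y + q) (projI B lambda))%:C)
        * \prod_(b <- partI B)
            (t b * cexp (t b * (frac_part B b (y + q))%:C) / (cexp (t b) - 1)).

(* No denominator in the generating function vanishes at t. These t form a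
   dense open set, the complement of the zeros of finitely many entire functions
   that are not identically zero. Two meromorphic functions of t are equal when
   they take the same values at these t; the value given by x / 0 = 0 at the
   other points is not the one of the meromorphic function. *)
Definition generating_function_regular : Prop :=
  forall B, B \in basesI ->
    (forall g, g \in Dstar `\` partI B -> root_denominator B g != 0)
    /\ (forall b, b \in partI B -> cexp (t b) - 1 != 0).

End GeneratingFunction.

Section TypeB.
Variables (R : realType) (r : nat).
Notation E := 'rV[R]_r.

(* The standard basis, indexed from 1: B_e 1, ..., B_e r. *)
Definition B_e (i : nat) : E := \row_k (k.+1 == i)%:R.

Definition B_positive_coroots : {fset E} :=
  [fset B_e i - B_e j | i in index_iota 1 r.+1, j in index_iota i.+1 r.+1]
  `|` [fset B_e i + B_e j | i in index_iota 1 r.+1, j in index_iota i.+1 r.+1]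
  `|` [fset 2 *: B_e j | j in index_iota 1 r.+1].

Definition B_simple_coroot (i : 'I_r) : E :=
  if i.+1 == r then 2 *: B_e r else B_e i.+1 - B_e i.+2.

(* The roots are recovered from their coroots by the same formula
   a |-> 2 a / <a, a>, since this map is an involution. *)
Definition B_root (c : E) : E := coroot c.
Definition B_positive_roots : {fset E} :=
  [fset B_root c | c in B_positive_coroots].
Definition B_roots : {fset E} :=
  B_positive_roots `|` [fset - a | a in B_positive_roots].
Definition B_simple_root (i : 'I_r) : E := B_root (B_simple_coroot i).

(* {2, ..., r}; an ordinal k : 'I_r stands for the index k + 1. *)
Definition B_I : {set 'I_r} := [set k : 'I_r | (2 <= k.+1)%N].

End TypeB.

Arguments B_e {R} r i.

(* m_j + ... + m_k, which is 0 when k < j. *)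
Definition m_range (m : nat -> int) (j k : nat) : int := \sum_(j <= i < k.+1) m i.

(* Main.v *)
Require Import Defs.
From mathcomp Require Import all_boot all_order all_algebra.
From mathcomp Require Import finmap.
From mathcomp Require Import all_classical all_reals all_analysis.
From mathcomp Require Import ring zify.

Import Order.TTheory GRing.Theory Num.Theory.
Local Open Scope complex_scope.
Local Open Scope ring_scope.

(** Since the complement of [I] is a single index, a basis [V] in the sum is
    [Psi_I] together with one root [b] of Delta^*, and Psi_I spans the hyperplane
    orthogonal to [e_1].  Hence Delta^* consists of the positive roots with
    nonzero first coordinate, [e_1 - e_j], [e_1 + e_j] and [e_1] (lemma
    [mem_Dstar]); each of them completes [Psi_I] to a basis, and the generating
    function has one summand for each (lemma [sum_basesI]).

    The dual vector of [b] is orthogonal to e_2, ..., e_r, so it is [e_1] for the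
    long roots [e_1 - e_j] and [e_1 + e_j], and [e_1 / 2] for the short root
    [e_1], whose coroot is [2 e_1].  In particular its pairing with [phi] is
    positive as soon as [<phi, lambda_1>] is, because [lambda_1 = e_1]; so all the
    fractional parts are ordinary ones.

    The lattice generated by a basis containing a long root is the whole coroot
    lattice, which leaves one coset; the short root gives a sublattice of index
    two, with cosets represented by [0] and by the simple coroot [e_1 - e_2]
    (lemmas [lattice_long_sub], [lattice_long_add], [lattice_short] and
    [not_lattice_short]).  The summand over [q] is constant on cosets because the
    coroots of the basis pair to integers both with the dual vector and with the
    projection of [lambda] (lemma [star_summand_periodic]), so the average over
    the quotient is a single value, or half the sum of two.

    What remains is to read off the coordinates of [lambda]: the differences
    [<e_i, lambda> - <e_j, lambda>] are the partial sums [m_i + ... + m_(j-1)],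
    [2 <e_r, lambda>] is [m_r], and the first two coordinates agree.  All
    denominators and exponents of the formula are linear in these coordinates. *)

Section GeneratingFunctionOfTypeB.

Local Set Implicit Arguments.
Local Unset Strict Implicit.
Local Unset Printing Implicit Defensive.
Local Open Scope classical_set_scope.
Local Open Scope fset_scope.
Local Open Scope complex_scope.
Local Open Scope ring_scope.

(** * Coroots, dual vectors and coroot lattices *)

Section InnerProduct.
Variables (R : realType) (n : nat).
Implicit Types (u v w : 'rV[R]_n) (S B : {fset 'rV[R]_n}).

Lemma dotC u v : dot u v = dot v u.
Proof. by apply: eq_bigr => k _; rewrite mulrC. Qed.

Lemma dotDl u v w : dot (u + v) w = dot u w + dot v w.
Proof. by rewrite -big_split; apply: eq_bigr => k _; rewrite !mxE mulrDl. Qed.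

Lemma dotZl a u v : dot (a *: u) v = a * dot u v.
Proof. by rewrite /dot mulr_sumr; apply: eq_bigr => k _; rewrite !mxE mulrA. Qed.

Lemma dot0l v : dot 0 v = 0.
Proof. by rewrite -[0 : 'rV[R]_n](scale0r 0) dotZl mul0r. Qed.

Lemma dotNl u v : dot (- u) v = - dot u v.
Proof. by rewrite -scaleN1r dotZl mulN1r. Qed.

Lemma dotBl u v w : dot (u - v) w = dot u w - dot v w.
Proof. by rewrite dotDl dotNl. Qed.

Lemma dotDr u v w : dot u (v + w) = dot u v + dot u w.
Proof. by rewrite dotC dotDl !(dotC u). Qed.

Lemma dotZr a u v : dot u (a *: v) = a * dot u v.
Proof. by rewrite dotC dotZl dotC. Qed.

Lemma dotNr u v : dot u (- v) = - dot u v.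
Proof. by rewrite dotC dotNl dotC. Qed.

Lemma dotBr u v w : dot u (v - w) = dot u v - dot u w.
Proof. by rewrite dotDr dotNr. Qed.

Lemma dot_suml (J : Type) (s : seq J) (P : pred J) F v :
  dot (\sum_(i <- s | P i) F i) v = \sum_(i <- s | P i) dot (F i) v.
Proof. by apply: (big_morph (fun u => dot u v)) => [u w|]; rewrite ?dotDl ?dot0l. Qed.

Lemma dot_sumr (J : Type) (s : seq J) (P : pred J) F v :
  dot v (\sum_(i <- s | P i) F i) = \sum_(i <- s | P i) dot v (F i).
Proof. by rewrite dotC dot_suml; apply: eq_bigr => i _; rewrite dotC. Qed.

Lemma dot_eq0 u : (dot u u == 0) = (u == 0).
Proof.
apply/eqP/eqP => [u0|->]; last by rewrite dot0l.
apply/rowP => k; rewrite mxE; apply/eqP; rewrite -sqrf_eq0 expr2.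
by rewrite (psumr_eq0P _ u0) // => i _; rewrite -expr2 sqr_ge0.
Qed.

Lemma corootK u : u != 0 -> coroot (coroot u) = u.
Proof.
rewrite -dot_eq0 => u0; rewrite /coroot dotZl dotZr scalerA.
by rewrite -[RHS]scale1r; congr (_ *: _); field.
Qed.

Lemma orthogonal_span X w v : (forall u, u \in X -> dot u w = 0) ->
  v \in <<X>>%VS -> dot v w = 0.
Proof.
move=> sw; rewrite -[X]/(tval (in_tuple X)) => /coord_span ->.
rewrite dot_suml big1 // => i _; rewrite dotZl sw ?mulr0 //.
exact: mem_nth.
Qed.

(** Vectors that pair to zero with every coroot of a spanning set are
    orthogonal to the whole space, so a dual basis is determined by its
    pairings. *)
Lemma coroot_dual_unique X v w : <<X>>%VS = fullv ->
  (forall b, b \in X -> dot (coroot b) v = dot (coroot b) w) -> v = w.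
Proof.
move=> Xfull vw; apply/eqP; rewrite -subr_eq0 -dot_eq0; apply/eqP.
apply: (@orthogonal_span X); last by rewrite Xfull memvf.
move=> b /vw /eqP; rewrite -subr_eq0 -dotBr dotZl mulf_eq0.
have [->|] := eqVneq b 0; first by rewrite !dot0l.
rewrite -dot_eq0 => b0.
by rewrite mulf_eq0 invr_eq0 (negbTE b0) pnatr_eq0 orbF => /eqP.
Qed.

Lemma dual_vectorE B b mu : <<enum_fset B>>%VS = fullv ->
  (forall b', b' \in B -> dot (coroot b') mu = (b' == b)%:R) ->
  dual_vector B b = mu.
Proof.
move=> Bfull muP; rewrite /dual_vector; case: xgetP => [x _ xP|/(_ mu)] //.
by apply: (coroot_dual_unique Bfull) => b' b'B; rewrite xP ?muP.
Qed.

Lemma fundamental_weightE (alpha : 'I_n -> 'rV[R]_n) j l :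
  <<codom alpha>>%VS = fullv ->
  (forall i, dot (coroot (alpha i)) l = (i == j)%:R) ->
  fundamental_weight alpha j = l.
Proof.
move=> full lP; rewrite /fundamental_weight; case: xgetP => [x _ xP|/(_ l)] //.
by apply: (coroot_dual_unique full) => _ /codomP[i ->]; rewrite xP lP.
Qed.

Lemma coroot_lattice0 S : coroot_lattice S 0.
Proof. by exists (fun=> 0); rewrite big1 // => b _; rewrite scale0r. Qed.

Lemma coroot_latticeB S u v :
  coroot_lattice S u -> coroot_lattice S v -> coroot_lattice S (u - v).
Proof.
move=> [c ->] [d ->]; exists (fun b => c b - d b).
by rewrite -sumrB; apply: eq_bigr => b _; rewrite rmorphB scalerBl.
Qed.

Lemma coroot_latticeN S u : coroot_lattice S u -> coroot_lattice S (- u).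
Proof. by rewrite -sub0r; apply: coroot_latticeB; apply: coroot_lattice0. Qed.

Lemma coroot_latticeD S u v :
  coroot_lattice S u -> coroot_lattice S v -> coroot_lattice S (u + v).
Proof. by move=> Su /coroot_latticeN; rewrite -{2}[v]opprK; apply: coroot_latticeB. Qed.

Lemma coroot_lattice_gen S b : b \in S -> coroot_lattice S (coroot b).
Proof.
move=> bS; exists (fun x => (x == b)%:R); rewrite (big_fsetD1 b) //= eqxx scale1r.
rewrite big1_fset ?addr0 // => x; rewrite !inE => /andP[/negbTE-> _] _.
by rewrite scale0r.
Qed.

(** This replaces coefficient functions by closure properties: inclusions between
    coroot lattices and integrality of pairings are checked on generators. *)
Lemma coroot_lattice_ind S (P : 'rV[R]_n -> Prop) :
    P 0 -> (forall u v, P u -> P v -> P (u - v)) ->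
    (forall b, b \in S -> P (coroot b)) ->
  forall v, coroot_lattice S v -> P v.
Proof.
move=> P0 PB Pgen _ [c ->].
have PN u : P u -> P (- u) by rewrite -sub0r; apply: PB.
have PD u v : P u -> P v -> P (u + v) by move=> Pu /PN; rewrite -{2}[v]opprK; apply: PB.
rewrite big_seq; apply: big_ind => // b /Pgen Pb.
have Pn (k : nat) : P (k%:R *: coroot b).
  by elim: k => [|k IH]; rewrite ?scale0r // -natr1 scalerDl scale1r; apply: PD.
by case: (c b) => k; rewrite ?NegzE ?rmorphN ?scaleNr; [|apply: PN]; apply: Pn.
Qed.

Lemma dot_lattice_int S w : (forall b, b \in S -> dot (coroot b) w \is a Num.int) ->
  forall v, coroot_lattice S v -> dot v w \is a Num.int.
Proof.
move=> Sw; apply: coroot_lattice_ind => //; first by rewrite dot0l.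
by move=> u v uw vw; rewrite dotBl rpredB.
Qed.

(** The elements of the coroot quotient are sets of this form. *)
Definition coset S (q : 'rV[R]_n) : set 'rV[R]_n :=
  [set q + l | l in coroot_lattice S].

Lemma coset_eqP S q q' : coset S q = coset S q' <-> coroot_lattice S (q - q').
Proof.
split=> [e|qq'].
  have : coset S q q by exists 0; rewrite ?addr0 //; apply: coroot_lattice0.
  by rewrite e => -[l Ll <-]; rewrite addrC addKr.
apply/seteqP; split=> _ [l Ll <-].
  by exists (q - q' + l); [apply: coroot_latticeD|rewrite addrA subrKC].
by exists (l - (q - q')); [apply: coroot_latticeB|rewrite opprB addrC -addrA subrK addrC].
Qed.

Lemma coset_repr S q : coroot_lattice S (xget 0 (coset S q) - q).
Proof.
case: xgetP => [x _ [l Ll <-]|/(_ q) h]; first by rewrite addrC addKr.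
by case: h; exists 0; rewrite ?addr0 //; apply: coroot_lattice0.
Qed.

Lemma coroot_quotient1 S B : (forall q, coroot_lattice S q -> coroot_lattice B q) ->
  coroot_quotient S B = [fset coset B 0].
Proof.
move=> SB; rewrite -[RHS]set_fsetK; congr fset_set.
apply/seteqP; split=> C /=; rewrite ?inE.
  by move=> [q Sq ->]; apply/coset_eqP; rewrite subr0; apply: SB.
by move=> ->; exists 0 => //; apply: coroot_lattice0.
Qed.

Lemma coroot_quotient2 S B a : coroot_lattice S a ->
    (forall q, coroot_lattice S q -> coroot_lattice B q \/ coroot_lattice B (q - a)) ->
  coroot_quotient S B = [fset coset B 0; coset B a].
Proof.
move=> Sa SB; rewrite -[RHS]set_fsetK; congr fset_set.
apply/seteqP; split=> C /=; rewrite in_fset2.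
  move=> [q /SB [Bq|Bq] ->]; rewrite -/(coset B q); apply/orP; [left|right];
    apply/eqP/coset_eqP => //.
  by rewrite subr0.
by case/orP => /eqP ->; [exists 0 => //; apply: coroot_lattice0|exists a].
Qed.

Section CosetSum.
Variables (A : fieldType) (S B : {fset 'rV[R]_n}) (f : 'rV[R]_n -> A).
Hypothesis f_periodic : forall q l, coroot_lattice B l -> f (q + l) = f q.

Let f_repr q : f (xget 0 (coset B q)) = f q.
Proof. by rewrite -[xget _ _](subrKC q) f_periodic //; apply: coset_repr. Qed.

(** With a lattice-periodic summand, the representative chosen in each coset does
    not matter, so the average over the quotient is computed with [0], and with
    [a] when there is a second coset. *)
Lemma coset_average1 :
    (forall q, coroot_lattice S q -> coroot_lattice B q) ->
  #|` coroot_quotient S B|%:R^-1 * \sum_(C <- coroot_quotient S B) f (xget 0 C) = f 0.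
Proof.
move=> /coroot_quotient1 ->.
by rewrite cardfs1 big_seq_fset1 f_repr invr1 mul1r.
Qed.

Lemma coset_average2 a : coroot_lattice S a -> ~ coroot_lattice B a ->
    (forall q, coroot_lattice S q -> coroot_lattice B q \/ coroot_lattice B (q - a)) ->
  #|` coroot_quotient S B|%:R^-1 * \sum_(C <- coroot_quotient S B) f (xget 0 C)
  = 2^-1 * (f 0 + f a).
Proof.
move=> Sa nBa /(coroot_quotient2 Sa) ->.
have a0 : coset B 0 != coset B a.
  by apply/eqP => /coset_eqP; rewrite sub0r => /coroot_latticeN; rewrite opprK.
rewrite cardfs2 a0 /= big_fsetU1 ?inE //= big_seq_fset1.
by rewrite !f_repr.
Qed.

End CosetSum.

End InnerProduct.

(** * Periodicity of the exponential and of the fractional part *)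

Section Periodicity.
Variable R : realType.

Lemma cexpD (z w : R[i]) : cexp (z + w) = cexp z * cexp w.
Proof.
case: z w => [a b] [c d]; rewrite /cexp /= expRD cosD sinD.
by apply/eqP; rewrite eq_complex /=; apply/andP; split; apply/eqP; ring.
Qed.

(** The value is [i] times a real number, so that [cexp] reduces to the sine and
    cosine of a real multiple of [2 pi]. *)
Lemma twopiiE (x : R) : twopii * x%:C = 0 +i* (pi *+ 2 * x).
Proof.
rewrite /twopii; move: (pi : R) => p.
have -> : (2 : R[i]) = (2 : R)%:C by rewrite rmorph_nat.
rewrite mulrAC -!rmorphM /= mulrC -[_%:C]/(_ +i* 0) -['i%C]/(0 +i* 1).
apply/eqP; rewrite eq_complex; apply/andP; split; apply/eqP.
  by rewrite [LHS]/= !mul0r mulr0 subr0.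
by rewrite [LHS]/= mul0r mul1r add0r [2 * p]mulr_natl.
Qed.

Lemma cexp_twopii_int (x : R) : x \is a Num.int -> cexp (twopii * x%:C) = 1.
Proof.
move=> /intrP[k ->].
have P (j : nat) : cos (pi *+ 2 * j%:R : R) = 1 /\ sin (pi *+ 2 * j%:R : R) = 0.
  elim: j => [|j [IHc IHs]]; first by rewrite mulr0 cos0 sin0.
  by rewrite -natr1 mulrDr mulr1 cosD cos2pi sin2pi sinD cos2pi sin2pi IHc IHs; split; ring.
rewrite twopiiE /cexp /= expR0 mul1r.
case: k => j; rewrite ?NegzE ?rmorphN ?mulrN ?cosN ?sinN; case: (P j) => //.
  by move=> -> ->.
by move=> _ _; case: (P j.+1) => -> ->; rewrite oppr0.
Qed.

Lemma fractionalDint (x k : R) : k \is a Num.int ->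
  fractional (x + k) = fractional x.
Proof.
move=> /intrP[j ->]; rewrite /fractional floorDrz ?intr_int // intrKfloor rmorphD /=.
by rewrite opprD addrACA subrr addr0.
Qed.

End Periodicity.

(** * Coordinates for the root system *)

Section TypeB.
Variables (R : realType) (r : nat) (hr : (2 <= r)%N).
Local Notation E := 'rV[R]_r.
Local Notation e i := (B_e r i : E).
Local Notation simple := (@B_simple_root R r).
Local Notation PsiI0 := (PsiI simple (B_I r)).
Local Notation Pos := (B_positive_roots R r).
Local Notation D := (Dstar (B_roots R r) (B_positive_roots R r) simple (B_I r)).
Implicit Types (v w b x : E) (X : seq E).

(** The vectors [e_i] are reached from [e_r] by adding simple coroots, which makes
    induction run from [r] downwards. *)
Lemma downward_ind (a : nat) (P : nat -> Prop) :
    ((a <= r)%N -> P r) -> (forall i, (a <= i < r)%N -> P i.+1 -> P i) ->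
  forall i, (a <= i <= r)%N -> P i.
Proof.
move=> Pr PS i; have [d rd] : exists d, d = (r - i)%N by exists (r - i)%N.
elim: d i rd => [|d IH] i rd ir; first by rewrite (_ : i = r); [apply: Pr|]; lia.
by apply: PS; [lia|apply: IH; lia].
Qed.

Lemma dot_ee i j : (0 < i <= r)%N -> dot (e i) (e j) = (i == j)%:R.
Proof.
case: i => // i /= ir; rewrite /dot (bigD1 (Ordinal ir)) //= big1 ?addr0.
  by rewrite !mxE eqxx mul1r.
by move=> k; rewrite -val_eqE !mxE eqSS /= => /negbTE->; rewrite mul0r.
Qed.

Lemma e_coord v : v = \sum_(k < r) v 0 k *: e k.+1.
Proof.
apply/rowP => k; rewrite summxE (bigD1 k) //= big1 ?addr0.
  by rewrite !mxE eqxx mulr1.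
by move=> l; rewrite -val_eqE !mxE eqSS eq_sym /= => /negbTE->; rewrite mulr0.
Qed.

Lemma coroot_short i : (0 < i <= r)%N -> coroot (2 *: e i) = e i.
Proof.
move=> ir; rewrite /coroot dotZl dotZr dot_ee // eqxx mulr1 scalerA.
by rewrite -[RHS]scale1r; congr (_ *: _); field.
Qed.

Lemma coroot_e i : (0 < i <= r)%N -> coroot (e i) = 2 *: e i.
Proof. by move=> ir; rewrite /coroot dot_ee // eqxx divr1. Qed.

Lemma coroot_sub i j : (0 < i <= r)%N -> (0 < j <= r)%N -> i != j ->
  coroot (e i - e j) = e i - e j.
Proof.
move=> ir jr ij; rewrite /coroot -[RHS]scale1r; congr (_ *: _).
rewrite dotBl !dotBr !dot_ee // !eqxx (negbTE ij) eq_sym (negbTE ij) /=.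
by field.
Qed.

Lemma coroot_add i j : (0 < i <= r)%N -> (0 < j <= r)%N -> i != j ->
  coroot (e i + e j) = e i + e j.
Proof.
move=> ir jr ij; rewrite /coroot -[RHS]scale1r; congr (_ *: _).
rewrite dotDl !dotDr !dot_ee // !eqxx (negbTE ij) eq_sym (negbTE ij) /=.
by field.
Qed.

Lemma e_neq0 i : (0 < i <= r)%N -> e i != 0.
Proof. by move=> ir; rewrite -dot_eq0 dot_ee // eqxx oner_eq0. Qed.

Lemma simple_rootE (k : 'I_r) :
  simple k = if k.+1 == r then e r else e k.+1 - e k.+2.
Proof.
rewrite /B_simple_root /B_simple_coroot /B_root; case: eqP => kr.
  by rewrite coroot_short //; lia.
by rewrite coroot_sub //; have := ltn_ord k; lia.
Qed.

Lemma coroot_simple (k : 'I_r) : coroot (simple k) = B_simple_coroot R k.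
Proof.
rewrite /B_simple_root /B_root corootK // /B_simple_coroot.
have kr := ltn_ord k; case: ifP => [_|/eqP kr'].
  by rewrite scaler_eq0 pnatr_eq0 e_neq0 //; lia.
rewrite -dot_eq0 dotBl !dotBr !dot_ee ?eqxx; try lia.
rewrite (ltn_eqF (ltnSn _)) (gtn_eqF (ltnSn _)) mulr0n mulr1n subr0 sub0r opprK.
by rewrite -mulr2n pnatr_eq0.
Qed.

Lemma dot_simple_coroot (k : 'I_r) v : dot (B_simple_coroot R k) v =
  if k.+1 == r then 2 * dot (e r) v else dot (e k.+1) v - dot (e k.+2) v.
Proof. by rewrite /B_simple_coroot; case: eqP => _; rewrite ?dotZl ?dotBl. Qed.

(** The last simple root is [e_r], and [e_i] is [e_(i+1)] plus a simple root. With
    [a = 1] this shows that the simple roots span; with [a = 2] it computes the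
    span of [Psi_I]. *)
Lemma e_in_span a X : (0 < a)%N ->
    (forall k : 'I_r, (a <= k.+1)%N -> simple k \in X) ->
  forall i, (a <= i <= r)%N -> e i \in <<X>>%VS.
Proof.
move=> a0 aX; apply: downward_ind => [ar|[|i] ir IH]; last 2 first.
- by lia.
- have ir' : (i < r)%N by lia.
  have /= := aX (Ordinal ir'); rewrite simple_rootE ifN /=; last by lia.
  move=> iX; rewrite -[e i.+1](subrK (e i.+2)).
  by apply: memvD => //; apply: memv_span; apply: iX; lia.
have rr : (r.-1 < r)%N by lia.
have /= := aX (Ordinal rr); rewrite simple_rootE /= prednK ?eqxx; last by lia.
by move=> rX; apply: memv_span; apply: rX.
Qed.

Lemma span_full X : (forall i, (0 < i <= r)%N -> e i \in <<X>>%VS) ->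
  <<X>>%VS = fullv.
Proof.
move=> eX; apply/vspaceP => v; rewrite memvf (e_coord v).
by apply: memv_suml => k _; apply/memvZ/eX; rewrite ltn_ord.
Qed.

Lemma mem_PsiI (k : 'I_r) : (1 < k.+1)%N -> simple k \in PsiI0.
Proof. by move=> k2; apply: in_imfset; rewrite inE. Qed.

Lemma PsiI_P b : b \in PsiI0 -> exists2 k : 'I_r, (1 < k.+1)%N & b = simple k.
Proof. by case/imfsetP => k /=; rewrite inE => k2 ->; exists k. Qed.

Lemma dot_e1_simple (k : 'I_r) : (1 < k.+1)%N -> dot (simple k) (e 1) = 0.
Proof.
move=> k2; have kr := ltn_ord k.
rewrite simple_rootE; case: eqP => rk; rewrite ?dotBl !dot_ee; try lia.
  by rewrite gtn_eqF.
by rewrite !gtn_eqF // subrr.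
Qed.

(** * The roots outside the parabolic subsystem, and the bases they give *)

(** An enumeration of Delta^* without repetitions; [e_1] is the root whose coroot
    is [2 e_1]. *)
Definition star_roots : seq E :=
  e 1 :: [seq e 1 - e j | j <- index_iota 2 r.+1]
      ++ [seq e 1 + e j | j <- index_iota 2 r.+1].

Lemma star_roots_ind (P : E -> Prop) : P (e 1) ->
    (forall j, (2 <= j <= r)%N -> P (e 1 - e j)) ->
    (forall j, (2 <= j <= r)%N -> P (e 1 + e j)) ->
  forall b, b \in star_roots -> P b.
Proof.
move=> P1 Pm Pp b; rewrite inE mem_cat => /predU1P[->//|/orP[]] /mapP[j];
  rewrite mem_index_iota ltnS => jr ->; [exact: Pm|exact: Pp].
Qed.

Lemma positive_sub i j : (0 < i < j)%N -> (j <= r)%N -> e i - e j \in Pos.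
Proof.
move=> ij jr; rewrite -coroot_sub; try lia.
apply: in_imfset; rewrite /= !inE; apply/orP; left; apply/orP; left.
apply/imfset2P; exists i; first by rewrite /= mem_index_iota; lia.
by exists j; rewrite //= mem_index_iota; lia.
Qed.

Lemma positive_add i j : (0 < i < j)%N -> (j <= r)%N -> e i + e j \in Pos.
Proof.
move=> ij jr; rewrite -coroot_add; try lia.
apply: in_imfset; rewrite /= !inE; apply/orP; left; apply/orP; right.
apply/imfset2P; exists i; first by rewrite /= mem_index_iota; lia.
by exists j; rewrite //= mem_index_iota; lia.
Qed.

Lemma positive_short i : (0 < i <= r)%N -> e i \in Pos.
Proof.
move=> ij; rewrite -coroot_short; try lia.
apply: in_imfset; rewrite /= !inE; apply/orP; right.
by apply/imfsetP; exists i => //=; rewrite mem_index_iota; lia.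
Qed.

Lemma positive_ind (P : E -> Prop) :
    (forall i j, (0 < i < j)%N -> (j <= r)%N -> P (e i - e j)) ->
    (forall i j, (0 < i < j)%N -> (j <= r)%N -> P (e i + e j)) ->
    (forall i, (0 < i <= r)%N -> P (e i)) ->
  forall b, b \in Pos -> P b.
Proof.
move=> Pm Pp P1 b /imfsetP[c /=]; rewrite !inE => + ->.
case/orP => [/orP[] /imfset2P[i /= iI [j /= jI ->]]|/imfsetP[j /= jI ->]];
  move: jI; rewrite ?mem_index_iota => jI; rewrite /B_root.
- by move: iI; rewrite mem_index_iota => iI; rewrite coroot_sub; try lia; apply: Pm; lia.
- by move: iI; rewrite mem_index_iota => iI; rewrite coroot_add; try lia; apply: Pp; lia.
by rewrite coroot_short; try lia; apply: P1; lia.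
Qed.

Lemma span_PsiI_e1 b : b \in <<enum_fset PsiI0>>%VS -> dot b (e 1) = 0.
Proof. by apply: orthogonal_span => _ /PsiI_P[k k2 ->]; apply: dot_e1_simple. Qed.

Lemma e_span_PsiI i : (2 <= i <= r)%N -> e i \in <<enum_fset PsiI0>>%VS.
Proof. by apply: e_in_span => // k; apply: mem_PsiI. Qed.

Lemma dot_star_e1 b : b \in star_roots -> dot b (e 1) = 1.
Proof.
move: b; apply: star_roots_ind => [|j jr|j jr]; rewrite ?dotBl ?dotDl !dot_ee; try lia.
- by [].
- by case/andP: jr => j2 _; rewrite eqxx gtn_eqF // subr0.
- by case/andP: jr => j2 _; rewrite eqxx gtn_eqF // addr0.
Qed.

(** A positive root lies in the span of [Psi_I] exactly when its first coordinate
    vanishes: pairing with [e_1] kills [Psi_I], whereas every [e_i] with [i >= 2]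
    is in the span. *)
Lemma mem_Dstar : D =i star_roots.
Proof.
move=> b; have Dmem : (b \in D) = (b \in Pos) && (b \notin <<enum_fset PsiI0>>%VS).
  rewrite /Dstar !inE; case: (b \in Pos) => /=; last by rewrite andbF.
  by rewrite !andbT.
rewrite Dmem; apply/andP/idP => [[]|bD].
  have mem_star c j : c \in [:: e 1; e 1 - e j; e 1 + e j] -> (2 <= j <= r)%N ->
      c \in star_roots.
    rewrite !inE mem_cat => cP jr; have {}jr : j \in index_iota 2 r.+1.
      by rewrite mem_index_iota ltnS.
    case/or3P: cP => /eqP->; apply/orP; [by left|right|right]; apply/orP; [left|right];
      exact: map_f.
  move: b {Dmem}; apply: positive_ind => [[//|[|i]] j ij jr|[//|[|i]] j ij jr|[//|[|i]] ir].
  - by move=> _; apply: (mem_star _ j); rewrite ?inE ?eqxx ?orbT; lia.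
  - by case/negP; apply: memvB; apply: e_span_PsiI; lia.
  - by move=> _; apply: (mem_star _ j); rewrite ?inE ?eqxx ?orbT; lia.
  - by case/negP; apply: memvD; apply: e_span_PsiI; lia.
  - by move=> _; apply: (mem_star _ 2); rewrite ?inE ?eqxx ?orbT; lia.
  - by case/negP; apply: e_span_PsiI; lia.
split; last by apply/negP => /span_PsiI_e1/eqP; rewrite dot_star_e1 // oner_eq0.
move: b bD {Dmem}; apply: star_roots_ind => [|j jr|j jr].
- by apply: positive_short; lia.
- by apply: positive_sub; lia.
- by apply: positive_add; lia.
Qed.

Lemma e_inj i j : (0 < i <= r)%N -> e i = e j -> i = j.
Proof.
move=> ir ij; have := dot_ee i ir; rewrite {2}ij dot_ee // eqxx.
by case: eqP => // _ /eqP; rewrite eq_sym oner_eq0.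
Qed.

Lemma sub_neq_short j : (2 <= j <= r)%N -> e 1 - e j != e 1.
Proof.
by move=> jr; rewrite -subr_eq0 addrAC subrr add0r oppr_eq0 e_neq0 //; lia.
Qed.

Lemma add_neq_short j : (2 <= j <= r)%N -> e 1 + e j != e 1.
Proof. by move=> jr; rewrite -subr_eq0 addrAC subrr add0r e_neq0 //; lia. Qed.

Lemma sub_neq_add i j : (2 <= i <= r)%N -> (2 <= j <= r)%N ->
  e 1 - e i != e 1 + e j.
Proof.
move=> ir jr; apply/eqP => /addrI /(congr1 (dot (e i))).
rewrite dotNr !dot_ee ?eqxx; [|lia|lia] => h.
by have := ler0n R (i == j); rewrite -h ler0N1.
Qed.

Lemma sub_inj i j : (2 <= i <= r)%N -> (e 1 - e i == e 1 - e j) = (i == j).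
Proof.
move=> ir; apply/eqP/eqP => [/addrI/oppr_inj/e_inj|-> //]; apply; lia.
Qed.

Lemma add_inj i j : (2 <= i <= r)%N -> (e 1 + e i == e 1 + e j) = (i == j).
Proof.
move=> ir; apply/eqP/eqP => [/addrI/e_inj|-> //]; apply; lia.
Qed.

Lemma uniq_star_roots : uniq star_roots.
Proof.
have inj_m : {in index_iota 2 r.+1 &, injective (fun j => e 1 - e j)}.
  by move=> i j; rewrite !mem_index_iota !ltnS => ir jr /eqP; rewrite sub_inj // => /eqP.
have inj_p : {in index_iota 2 r.+1 &, injective (fun j => e 1 + e j)}.
  by move=> i j; rewrite !mem_index_iota !ltnS => ir jr /eqP; rewrite add_inj // => /eqP.
rewrite /star_roots /= cat_uniq !map_inj_in_uniq // iota_uniq andbT /= mem_cat.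
apply/andP; split.
  apply/negP => /orP[] /mapP[j]; rewrite mem_index_iota ltnS => jr /esym/eqP.
    by apply/negP/sub_neq_short.
  by apply/negP/add_neq_short.
apply/hasPn => _ /mapP[i + ->]; rewrite mem_index_iota ltnS => ir.
apply/negP => /mapP[j]; rewrite mem_index_iota ltnS => jr /esym/eqP.
by apply/negP/sub_neq_add.
Qed.

Definition B_basis b : {fset E} := [fset b] `|` PsiI0.

Lemma span_B_basis b : b \in star_roots -> <<enum_fset (B_basis b)>>%VS = fullv.
Proof.
move=> bS; apply: span_full => i ir.
have e2 j : (2 <= j <= r)%N -> e j \in <<enum_fset (B_basis b)>>%VS.
  move=> jr; move: (e_span_PsiI jr); apply: (subvP (sub_span _)) => c cP.
  by rewrite in_fsetU cP orbT.
case: (ltngtP i 1) => [|i2|->]; [lia|by apply: e2; lia|].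
have : b \in <<enum_fset (B_basis b)>>%VS by rewrite memv_span // !inE eqxx.
move: bS; set V := <<_>>%VS in e2 *; move: V e2 => V e2.
move: b; apply: star_roots_ind => // j /e2 jV b1; first by rewrite -[e 1](subrK (e j)) memvD.
by rewrite -[e 1](addrK (e j)) memvB.
Qed.

(** The dual vector of [b] in its basis: being orthogonal to [Psi_I], it is a
    multiple of [e_1]. *)
Definition star_dual b : E := (dot (coroot b) (e 1))^-1 *: e 1.

Lemma dot_star_dual b b' : b \in star_roots -> b' \in B_basis b ->
  dot (coroot b') (star_dual b) = (b' == b)%:R.
Proof.
move=> bS; have b1 := dot_star_e1 bS.
have bb : dot (coroot b) (e 1) != 0.
  rewrite dotZl b1 mulr1 mulf_neq0 ?pnatr_eq0 // invr_eq0 dot_eq0.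
  by apply: contra_eq_neq b1 => ->; rewrite dot0l eq_sym oner_neq0.
rewrite !inE => /predU1P[->|/PsiI_P[k k2 b'E]].
  by rewrite eqxx dotZr mulVf.
have k0 : dot (coroot (simple k)) (e 1) = 0 by rewrite dotZl dot_e1_simple // mulr0.
rewrite b'E dotZr k0 mulr0.
suff /negbTE-> : simple k != b by [].
by apply: contra_eq_neq b1 => <-; rewrite dot_e1_simple // eq_sym oner_neq0.
Qed.

Lemma dual_B_basis b : b \in star_roots -> dual_vector (B_basis b) b = star_dual b.
Proof.
move=> bS; apply: dual_vectorE; first exact: span_B_basis.
by move=> b'; apply: dot_star_dual.
Qed.

Lemma disjoint_PsiI_Dstar b : b \in PsiI0 -> b \notin D.
Proof.
move=> /PsiI_P[k k2 ->]; rewrite mem_Dstar //; apply/negP => /dot_star_e1/eqP.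
by rewrite dot_e1_simple // eq_sym oner_eq0.
Qed.

Lemma partI_B_basis b : b \in star_roots ->
  partI (B_roots R r) Pos simple (B_I r) (B_basis b) = [fset b].
Proof.
move=> bS; apply/fsetP => x; rewrite in_fsetI in_fsetU in_fset1.
have [->|_] := eqVneq x b; first by rewrite mem_Dstar.
by apply/andP => -[/disjoint_PsiI_Dstar/negP].
Qed.

Lemma projI_B_basis b v : b \in star_roots ->
  projI (B_roots R r) Pos simple (B_I r) (B_basis b) v
  = v - dot (coroot b) v *: star_dual b.
Proof.
by move=> bS; rewrite /projI partI_B_basis // big_seq_fset1 dual_B_basis.
Qed.

Lemma card_setC_B_I : #|~: B_I r| = 1%N.
Proof.
rewrite (_ : ~: B_I r = [set Ordinal (ltnW hr)]%SET) ?cards1 //.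
by apply/setP => k; rewrite !inE -val_eqE /=; case: (val k) => [|[|]].
Qed.

(** The basis property follows from spanning, by counting at most [r] elements. *)
Lemma basis_B_basis b : b \in star_roots -> basis_of fullv (enum_fset (B_basis b)).
Proof.
move=> bS; rewrite basisEdim span_B_basis // subvv dimvf /dim /= mul1n.
rewrite (leq_trans (leq_card_fsetU _ _)) // cardfs1.
rewrite (leq_ltn_trans (leq_imfset_card _ _ _)) // -cardE.
by rewrite -[X in (_ < X)%N]card_ord -(cardsC (B_I r)) card_setC_B_I addn1.
Qed.

(** Distinct roots give distinct bases, since [b] is recovered as the part of its
    basis in Delta^*. *)
Lemma sum_basesI (A : nmodType) (f : {fset E} -> A) :
  \sum_(B <- basesI (B_roots R r) Pos simple (B_I r)) f B
  = \sum_(b <- star_roots) f (B_basis b).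
Proof.
rewrite -(big_map B_basis xpredT f); apply: perm_big; apply: uniq_perm.
- exact: fset_uniq.
- rewrite map_inj_in_uniq ?uniq_star_roots // => b c bS cS bc.
  have := partI_B_basis cS; rewrite -bc partI_B_basis // => /fsetP/(_ b).
  by rewrite !inE eqxx => /esym/eqP.
move=> x; apply/imfsetP/mapP => [[W /=]|[b bS ->]].
  rewrite !inE fpowersetE card_setC_B_I => /and3P[WD /cardfs1P[b Wb] _] ->.
  exists b; last by rewrite Wb.
  by rewrite -mem_Dstar //; apply: (fsubsetP WD); rewrite Wb inE.
exists [fset b] => //=; rewrite !inE fpowersetE card_setC_B_I cardfs1 /=.
by rewrite fsub1set mem_Dstar // bS; apply: basis_B_basis.
Qed.

Lemma prod_Dstar (A : comNzRingType) b (f : E -> A) :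
  \prod_(g <- D `\` [fset b]) f g = \prod_(g <- star_roots | g != b) f g.
Proof.
rewrite -[RHS]big_filter; apply: perm_big; apply: uniq_perm.
- exact: fset_uniq.
- by rewrite filter_uniq // uniq_star_roots.
by move=> x; rewrite mem_filter in_fsetD in_fset1 mem_Dstar.
Qed.

Lemma big_nat_neq (A : comNzRingType) (f : nat -> A) a n j : (a <= j < n)%N ->
  \prod_(a <= i < n | i != j) f i
  = \prod_(a <= i < j) f i * \prod_(j.+1 <= i < n) f i.
Proof.
move=> /andP[aj jn]; rewrite (big_cat_nat aj (ltnW jn)) /=; congr (_ * _).
  by rewrite big_nat_cond [RHS]big_nat; apply: eq_bigl => i; lia.
rewrite big_ltn_cond // eqxx /=.
by rewrite big_nat_cond [RHS]big_nat; apply: eq_bigl => i; lia.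
Qed.

Lemma eq_bigl_nat (A : Type) (idx : A) (op : A -> A -> A) a n (P Q : pred nat) f :
    (forall i, (a <= i <= n)%N -> P i = Q i) ->
  \big[op/idx]_(a <= i < n.+1 | P i) f i = \big[op/idx]_(a <= i < n.+1 | Q i) f i.
Proof.
move=> PQ; rewrite big_nat_cond [RHS]big_nat_cond; apply: eq_bigl => i.
by rewrite ltnS; case: (boolP (a <= i <= n)%N) => //= /PQ.
Qed.

Section Products.
Variables (A : comNzRingType) (f : E -> A).

Lemma prod_star_roots (P : pred E) : \prod_(g <- star_roots | P g) f g =
  (if P (e 1) then f (e 1) else 1)
  * \prod_(2 <= i < r.+1 | P (e 1 - e i)) f (e 1 - e i)
  * \prod_(2 <= i < r.+1 | P (e 1 + e i)) f (e 1 + e i).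
Proof.
by rewrite big_cons big_cat !big_map mulrA; case: (P (e 1)) => //; rewrite mul1r.
Qed.

Lemma prod_star_short : \prod_(g <- star_roots | g != e 1) f g =
  \prod_(2 <= i < r.+1) f (e 1 - e i) * \prod_(2 <= i < r.+1) f (e 1 + e i).
Proof.
rewrite prod_star_roots eqxx mul1r; congr (_ * _); apply: eq_bigl_nat => i ir.
  by rewrite sub_neq_short.
by rewrite add_neq_short.
Qed.

Lemma prod_star_sub j : (2 <= j <= r)%N ->
  \prod_(g <- star_roots | g != e 1 - e j) f g =
  \prod_(2 <= i < j) f (e 1 - e i) * \prod_(j.+1 <= i < r.+1) f (e 1 - e i)
  * \prod_(2 <= i < j.+1) f (e 1 + e i) * \prod_(j.+1 <= i < r.+1) f (e 1 + e i)
  * f (e 1).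
Proof.
move=> jr; rewrite prod_star_roots eq_sym sub_neq_short //.
rewrite (@eq_bigl_nat _ _ _ _ _ _ (fun i => i != j)); last by move=> i ir; rewrite sub_inj.
rewrite big_nat_neq ?ltnS // [X in _ * X](@eq_bigl_nat _ _ _ _ _ _ xpredT).
  by rewrite [X in _ * X](@big_cat_nat _ _ _ j.+1) ?ltnS //=; [ring|lia|lia].
by move=> i ir; rewrite eq_sym sub_neq_add.
Qed.

Lemma prod_star_add j : (2 <= j <= r)%N ->
  \prod_(g <- star_roots | g != e 1 + e j) f g =
  \prod_(2 <= i < j.+1) f (e 1 - e i) * \prod_(j.+1 <= i < r.+1) f (e 1 - e i)
  * \prod_(2 <= i < j) f (e 1 + e i) * \prod_(j.+1 <= i < r.+1) f (e 1 + e i)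
  * f (e 1).
Proof.
move=> jr; rewrite prod_star_roots eq_sym add_neq_short //.
rewrite [X in _ * X](@eq_bigl_nat _ _ _ _ _ _ (fun i => i != j)); last first.
  by move=> i ir; rewrite add_inj.
rewrite (@big_nat_neq _ _ _ _ j) ?ltnS // (@eq_bigl_nat _ _ _ 2 r _ xpredT).
  by rewrite (@big_cat_nat _ _ _ j.+1 2 r.+1) ?ltnS //=; [ring|lia|lia].
by move=> i ir; rewrite sub_neq_add.
Qed.

End Products.

Lemma sum_star_roots (A : nmodType) (f : E -> A) : \sum_(g <- star_roots) f g =
  \sum_(2 <= j < r.+1) f (e 1 - e j) + \sum_(2 <= j < r.+1) f (e 1 + e j) + f (e 1).
Proof. by rewrite big_cons big_cat !big_map [RHS]addrC. Qed.

(** * Fundamental weights and the index of the lattices *)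

Section WeightsAndLattices.

Definition B_fundamental_weight (j : 'I_r) : E :=
  (if j.+1 == r then 2^-1 else 1) *: \sum_(k < r | (k <= j)%N) e k.+1.

Lemma dot_fundamental_weight i (j : 'I_r) : (0 < i <= r)%N ->
  dot (e i) (B_fundamental_weight j)
  = (if j.+1 == r then 2^-1 else 1) * (i <= j.+1)%:R.
Proof.
case: i => // i /= ir; rewrite dotZr dot_sumr; congr (_ * _).
rewrite (eq_bigr (fun k : 'I_r => (k == Ordinal ir)%:R)); last first.
  by move=> k _; rewrite dot_ee // eqSS eq_sym -val_eqE.
rewrite big_mkcond (bigD1 (Ordinal ir)) //= eqxx big1 ?addr0 => [|k /negbTE->].
  by rewrite ltnS; case: (i <= j)%N.
by rewrite if_same.
Qed.

Lemma dot_simple_fundamental_weight (i j : 'I_r) :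
  dot (B_simple_coroot R i) (B_fundamental_weight j) = (i == j)%:R.
Proof.
rewrite dot_simple_coroot -(inj_eq val_inj) /=.
have [ir jr] := (ltn_ord i, ltn_ord j).
case: eqP => ir'; [rewrite dot_fundamental_weight; [|lia]
                  |rewrite !dot_fundamental_weight; [|lia..]].
  have -> : (i == j :> nat) = (j.+1 == r) by lia.
  have -> : (r <= j.+1)%N = (j.+1 == r) by lia.
  by case: eqP => _; rewrite ?mulr0 // mulr1 divff ?pnatr_eq0.
rewrite !ltnS; case: (ltngtP i j) => ij; rewrite ?subrr //.
by rewrite ifF ?mul1r ?mulr0 ?subr0 //; lia.
Qed.

Lemma fundamental_weight_B j : fundamental_weight simple j = B_fundamental_weight j.
Proof.
apply: fundamental_weightE.
  apply: span_full => i ir; apply: (@e_in_span 1) => // k _; exact: codom_f.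
by move=> i; rewrite coroot_simple dot_simple_fundamental_weight.
Qed.

Lemma fundamental_weight1 : fundamental_weight simple (Ordinal (ltnW hr)) = e 1.
Proof.
rewrite fundamental_weight_B /B_fundamental_weight ifF /=; last by lia.
rewrite scale1r (big_pred1 (Ordinal (ltnW hr))) // => k.
by rewrite /= leqn0 -val_eqE.
Qed.

(** The step [e_i + e_r = (e_i - e_(i+1)) + (e_(i+1) + e_r)] starts from the simple
    coroot [2 e_r = e_r + e_r]; a lattice containing the simple coroots from
    position [a] on thus contains all sums and differences of [e_i] with
    [i >= a]. *)
Lemma lattice_add_last (S : {fset E}) a : (0 < a)%N ->
    (forall k : 'I_r, (a <= k.+1)%N -> simple k \in S) ->
  forall i, (a <= i <= r)%N -> coroot_lattice S (e i + e r).
Proof.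
move=> a0 aS; apply: downward_ind => [ar|[|i] ir IH]; last 2 first.
- by lia.
- have ir' : (i < r)%N by lia.
  rewrite -[e i.+1](subrK (e i.+2)) -addrA; apply: coroot_latticeD => //.
  have := @coroot_lattice_gen _ _ S _ (aS (Ordinal ir') _).
  rewrite coroot_simple /B_simple_coroot ifN /=; last by lia.
  by apply; lia.
have rr : (r.-1 < r)%N by lia.
have := @coroot_lattice_gen _ _ S _ (aS (Ordinal rr) _).
rewrite coroot_simple /B_simple_coroot /= prednK ?eqxx; last by lia.
by rewrite scaler_nat mulr2n; apply.
Qed.

Lemma lattice_sub (S : {fset E}) a : (0 < a)%N ->
    (forall k : 'I_r, (a <= k.+1)%N -> simple k \in S) ->
  forall i j, (a <= i <= r)%N -> (a <= j <= r)%N -> coroot_lattice S (e i - e j).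
Proof.
move=> a0 aS i j ir jr; have L := lattice_add_last a0 aS.
by have := coroot_latticeB (L _ ir) (L _ jr); rewrite opprD addrACA subrr addr0.
Qed.

Lemma lattice_add (S : {fset E}) a : (0 < a)%N ->
    (forall k : 'I_r, (a <= k.+1)%N -> simple k \in S) ->
  forall i j, (a <= i <= r)%N -> (a <= j <= r)%N -> coroot_lattice S (e i + e j).
Proof.
move=> a0 aS i j ir jr; have L := lattice_add_last a0 aS.
have := coroot_latticeD (L _ ir) (lattice_sub a0 aS jr (_ : (a <= r <= r)%N)).
by rewrite addrACA subrr addr0; apply; lia.
Qed.

Lemma PsiI_sub_basis b (k : 'I_r) : (2 <= k.+1)%N -> simple k \in B_basis b.
Proof. by move=> k2; rewrite in_fsetU mem_PsiI ?orbT. Qed.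

Local Notation Q := (coroot_lattice (Psi_ simple)).

Lemma simple_Psi (k : 'I_r) : simple k \in Psi_ simple.
Proof. exact: in_imfset. Qed.

Lemma Psi_P b : b \in Psi_ simple -> exists k : 'I_r, b = simple k.
Proof. by case/imfsetP => k _ ->; exists k. Qed.

Lemma coroot_simple1 (k : 'I_r) : val k = 0 -> coroot (simple k) = e 1 - e 2.
Proof.
by move=> k0; rewrite coroot_simple /B_simple_coroot k0 ifN //; lia.
Qed.

(** The only simple coroot missing from [Psi_I] is recovered as
    [e_1 - e_2 = (e_1 - e_j) + (e_j - e_2)]; for [e_1 + e_j] it is
    [(e_1 + e_j) - (e_j + e_2)]. *)
Lemma lattice_long_sub j : (2 <= j <= r)%N ->
  forall q, Q q -> coroot_lattice (B_basis (e 1 - e j)) q.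
Proof.
move=> jr; apply: coroot_lattice_ind; first exact: coroot_lattice0.
  by move=> u v; apply: coroot_latticeB.
move=> _ /Psi_P[k ->]; have [k2|] := ltnP 1 k.+1.
  by apply: coroot_lattice_gen; apply: PsiI_sub_basis.
rewrite ltnS leqn0 => /eqP/coroot_simple1->.
rewrite (_ : e 1 - e 2 = (e 1 - e j) + (e j - e 2)); last by rewrite addrA subrK.
apply: coroot_latticeD.
  rewrite -{2}coroot_sub; [|lia..].
  by apply: coroot_lattice_gen; rewrite !inE eqxx.
by apply: (@lattice_sub _ 2) => //; exact: PsiI_sub_basis.
Qed.

Lemma lattice_long_add j : (2 <= j <= r)%N ->
  forall q, Q q -> coroot_lattice (B_basis (e 1 + e j)) q.
Proof.
move=> jr; apply: coroot_lattice_ind; first exact: coroot_lattice0.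
  by move=> u v; apply: coroot_latticeB.
move=> _ /Psi_P[k ->]; have [k2|] := ltnP 1 k.+1.
  by apply: coroot_lattice_gen; apply: PsiI_sub_basis.
rewrite ltnS leqn0 => /eqP/coroot_simple1->.
rewrite (_ : e 1 - e 2 = (e 1 + e j) - (e j + e 2)); last by rewrite opprD addrA addrK.
apply: coroot_latticeB.
  rewrite -{2}coroot_add; [|lia..].
  by apply: coroot_lattice_gen; rewrite !inE eqxx.
by apply: (@lattice_add _ 2) => //; exact: PsiI_sub_basis.
Qed.

(** Twice [e_1 - e_2] is [2 e_1 - (e_2 + e_2)], an element of the lattice of
    the short root, so that lattice and its translate by [e_1 - e_2] together
    form a group containing all simple coroots. *)
Lemma lattice_short q : Q q -> coroot_lattice (B_basis (e 1)) q \/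
  coroot_lattice (B_basis (e 1)) (q - (e 1 - e 2)).
Proof.
set L := coroot_lattice (B_basis (e 1)); set a := e 1 - e 2.
have L2a : L (a + a).
  rewrite addrACA -opprD -mulr2n -scaler_nat -coroot_e; last by lia.
  apply: coroot_latticeB; first by apply: coroot_lattice_gen; rewrite !inE eqxx.
  by apply: (@lattice_add _ 2) => //; exact: PsiI_sub_basis.
move: q; apply: coroot_lattice_ind; first by left; apply: coroot_lattice0.
  move=> u v [Lu|Lu] [Lv|Lv].
  - by left; apply: coroot_latticeB.
  - right; rewrite (_ : u - v - a = u - (v - a) - (a + a)).
      by apply: coroot_latticeB => //; apply: coroot_latticeB.
    by clearbody a; rewrite opprB addrA opprD addrA [u + a - v]addrAC addrK.
  - by right; rewrite addrAC; apply: coroot_latticeB.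
  - by left; have := coroot_latticeB Lu Lv; clearbody a; rewrite opprB subrKA.
move=> _ /Psi_P[k ->]; have [k2|] := ltnP 1 k.+1.
  by left; apply: coroot_lattice_gen; apply: PsiI_sub_basis.
rewrite ltnS leqn0 => /eqP/coroot_simple1->.
by right; rewrite subrr; apply: coroot_lattice0.
Qed.

Lemma star_dual_short : star_dual (e 1) = 2^-1 *: e 1.
Proof. by rewrite /star_dual coroot_e ?dotZl ?dot_ee ?eqxx ?mulr1 //; lia. Qed.

Lemma star_dual_sub j : (2 <= j <= r)%N -> star_dual (e 1 - e j) = e 1.
Proof.
move=> jr; rewrite /star_dual coroot_sub ?dotBl ?dot_ee; [|lia..].
by rewrite eqxx gtn_eqF ?subr0 ?invr1 ?scale1r //; lia.
Qed.

Lemma star_dual_add j : (2 <= j <= r)%N -> star_dual (e 1 + e j) = e 1.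
Proof.
move=> jr; rewrite /star_dual coroot_add ?dotDl ?dot_ee; [|lia..].
by rewrite eqxx gtn_eqF ?addr0 ?invr1 ?scale1r //; lia.
Qed.

Lemma e1_star : e 1 \in star_roots. Proof. by rewrite inE eqxx. Qed.

Lemma sub_star j : (2 <= j <= r)%N -> e 1 - e j \in star_roots.
Proof.
move=> jr; rewrite inE mem_cat; apply/or3P/Or32.
by apply: (map_f (fun j => e 1 - e j)); rewrite mem_index_iota ltnS.
Qed.

Lemma add_star j : (2 <= j <= r)%N -> e 1 + e j \in star_roots.
Proof.
move=> jr; rewrite inE mem_cat; apply/or3P/Or33.
by apply: (map_f (fun j => e 1 + e j)); rewrite mem_index_iota ltnS.
Qed.

(** Elements of the lattice pair to integers with [e_1 / 2], and [e_1 - e_2] pairs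
    to [1 / 2]. *)
Lemma not_lattice_short : ~ coroot_lattice (B_basis (e 1)) (e 1 - e 2).
Proof.
move=> L; have : dot (e 1 - e 2) (star_dual (e 1)) \is a Num.int.
  by apply: dot_lattice_int L => b bB; rewrite dot_star_dual ?e1_star //.
rewrite star_dual_short dotZr dotBl !dot_ee ?eqxx /= ?subr0 ?mulr1; [|lia..].
move/intrP => [z zE]; have : 2 * z = 1 :> int; last by lia.
by apply: (@intr_inj R); rewrite rmorphM /= -zE divff // pnatr_eq0.
Qed.

End WeightsAndLattices.

(** * The coordinates of lambda and of y *)

Section GeneratingFunctionB.
Variables (phi : E) (y : nat -> R) (m : nat -> int) (t : E -> R[i]).
Hypothesis phi1 : 0 < dot phi (e 1).
Let Y : E := \sum_(k < r) y k.+1 *: B_simple_coroot R k.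
Let lambda : E := \sum_(k in B_I r) (m k.+1)%:~R *: fundamental_weight simple k.
Let lam i : R := dot (e i) lambda.

Lemma dot_simple_lambda (k : 'I_r) :
  dot (B_simple_coroot R k) lambda = (if (1 < k.+1)%N then m k.+1 else 0)%:~R.
Proof.
rewrite dot_sumr big_mkcond (bigD1 k) //= big1 ?addr0 => [|l lk].
  rewrite inE; case: ifP => // _.
  by rewrite dotZr fundamental_weight_B dot_simple_fundamental_weight eqxx mulr1.
case: ifP => // _; rewrite dotZr fundamental_weight_B.
by rewrite dot_simple_fundamental_weight eq_sym (negbTE lk) mulr0.
Qed.

Lemma lam_step i : (2 <= i < r)%N -> lam i - lam i.+1 = (m i)%:~R.
Proof.
case: i => // i ir; have ir' : (i < r)%N by lia.
have := dot_simple_lambda (Ordinal ir'); rewrite dot_simple_coroot /= ifN; last by lia.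
by rewrite ifT //; lia.
Qed.

(** The simple coroot [e_1 - e_2] kills [lambda], which has no component along
    [lambda_1]. *)
Lemma lam1 : lam 1 = lam 2.
Proof.
apply/eqP; rewrite -subr_eq0; apply/eqP.
have := dot_simple_lambda (Ordinal (ltnW hr)); rewrite dot_simple_coroot /= ifN //.
by lia.
Qed.

Lemma lam_last : 2 * lam r = (m r)%:~R.
Proof.
have rr : (r.-1 < r)%N by lia.
have := dot_simple_lambda (Ordinal rr); rewrite dot_simple_coroot /= prednK ?eqxx; last by lia.
by rewrite ifT //; lia.
Qed.

(** Telescoping of [lam_step]. *)
Lemma sum_m i j : (2 <= i <= j)%N -> (j <= r)%N ->
  \sum_(i <= k < j) (m k)%:~R = lam i - lam j :> R.
Proof.
move=> ij jr; rewrite -[RHS]opprB -telescope_sumr; last by lia.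
rewrite -sumrN; apply: eq_big_nat => k kij; rewrite opprB lam_step //; lia.
Qed.

Lemma m_rangeE i j : (2 <= i <= j)%N -> (j <= r)%N ->
  (m_range m i j.-1)%:~R = lam i - lam j.
Proof.
move=> ij jr; rewrite -sum_m // /m_range prednK; last by lia.
by rewrite rmorph_sum.
Qed.

Let lamC i : R[i] := (lam i)%:C.

Lemma m_rangeC i j : (2 <= i <= j)%N -> (j <= r)%N ->
  (m_range m i j.-1)%:~R = lamC i - lamC j.
Proof.
by move=> ij jr; rewrite -rmorphB -m_rangeE // rmorph_int.
Qed.

Lemma sum_mC i j : (2 <= i <= j)%N -> (j <= r)%N ->
  \sum_(i <= k < j) (m k)%:~R = lamC i - lamC j.
Proof.
move=> ij jr; rewrite -m_rangeC // /m_range prednK; last by lia.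
by rewrite rmorph_sum.
Qed.

Lemma mC_last : (m r)%:~R = 2 * lamC r.
Proof.
by rewrite -(rmorph_int (real_complex R)) -lam_last rmorphM rmorph_nat.
Qed.

Lemma dot_Y v : dot Y v = \sum_(k < r) y k.+1 * dot (B_simple_coroot R k) v.
Proof. by rewrite dot_suml; apply: eq_bigr => k _; rewrite dotZl. Qed.

Lemma dot_Y_e1 : dot Y (e 1) = y 1.
Proof.
rewrite dot_Y (bigD1 (Ordinal (ltnW hr))) //= big1 ?addr0 => [|k k0].
  rewrite dot_simple_coroot ifN /=; last by lia.
  by rewrite !dot_ee //= ?subr0 ?mulr1 //; lia.
have k2 : (1 < k.+1)%N by rewrite ltnS lt0n; apply: contra k0 => /eqP k0; apply/eqP/val_inj.
rewrite -coroot_simple /coroot dotZl dot_e1_simple //.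
by rewrite !mulr0.
Qed.

Lemma dot_Y_lambda : (dot Y lambda)%:C = \sum_(2 <= i < r.+1) (m i)%:~R * (y i)%:C.
Proof.
rewrite dot_Y rmorph_sum (eq_bigr (fun k : 'I_r =>
  (if (1 < k.+1)%N then m k.+1 else 0)%:~R * (y k.+1)%:C)); last first.
  by move=> k _; rewrite dot_simple_lambda rmorphM rmorph_int mulrC.
rewrite -(big_mkord xpredT (fun k => (if (1 < k.+1)%N then m k.+1 else 0)%:~R * (y k.+1)%:C)).
rewrite big_ltn ?mul0r ?add0r; last by lia.
rewrite [RHS]big_add1 /=; apply: eq_big_nat => k kr.
by rewrite ifT //; lia.
Qed.

(** * The summand of each root *)

Definition star_proj b : E := lambda - dot (coroot b) lambda *: star_dual b.

Definition star_denominator b g : R[i] :=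
  t g - t b * (dot (coroot g) (star_dual b))%:C - twopii * (dot (coroot g) (star_proj b))%:C.

Definition star_summand b q : R[i] :=
  cexp (twopii * (dot (Y + q) (star_proj b))%:C)
  * (t b * cexp (t b * (fractional (dot (Y + q) (star_dual b)))%:C) / (cexp (t b) - 1)).

Lemma star_dual_phi b : b \in star_roots -> 0 < dot phi (star_dual b).
Proof.
move: b; apply: star_roots_ind => [|j jr|j jr].
- by rewrite star_dual_short dotZr mulr_gt0 // invr_gt0.
- by rewrite star_dual_sub.
- by rewrite star_dual_add.
Qed.

Let average b := let Qt := coroot_quotient (Psi_ simple) (B_basis b) in
  #|` Qt|%:R^-1 * \sum_(C <- Qt) star_summand b (xget 0 C).

Lemma generating_function_star :
  generating_function (B_roots R r) Pos simple (B_I r) phi t Y lambda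
  = \sum_(b <- star_roots)
      (\prod_(g <- star_roots | g != b) (t g / star_denominator b g)) * average b.
Proof.
rewrite /generating_function sum_basesI; apply: eq_big_seq => b bS.
rewrite partI_B_basis // prod_Dstar -mulrA; congr (_ * (_ * _)).
  apply: eq_bigr => g _; rewrite /root_denominator partI_B_basis // big_seq_fset1.
  by rewrite dual_B_basis // projI_B_basis.
apply: eq_bigr => C _; rewrite big_seq_fset1 /frac_part dual_B_basis //.
by rewrite projI_B_basis // star_dual_phi.
Qed.

(** The coroot of [b] is orthogonal to the projection of [lambda], and the simple
    coroots in the basis pair with it to the integers [m_k]. *)
Lemma star_summand_periodic b : b \in star_roots ->
  forall q l, coroot_lattice (B_basis b) l -> star_summand b (q + l) = star_summand b q.
Proof.
move=> bS q l Ll; rewrite /star_summand addrA !(dotDl (Y + q)).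
have l_dual : dot l (star_dual b) \is a Num.int.
  by apply: dot_lattice_int Ll => b' b'B; rewrite dot_star_dual ?rpred_nat.
have l_proj : dot l (star_proj b) \is a Num.int.
  apply: dot_lattice_int Ll => b' b'B; rewrite dotBr dotZr dot_star_dual //.
  have [->|b'b] := eqVneq b' b; first by rewrite mulr1 subrr.
  rewrite mulr0 subr0; move: b'B; rewrite !inE (negbTE b'b) => /PsiI_P[k _ ->].
  by rewrite coroot_simple dot_simple_lambda intr_int.
by rewrite fractionalDint // rmorphD mulrDr cexpD (cexp_twopii_int l_proj) mulr1.
Qed.

Lemma average_sub j : (2 <= j <= r)%N ->
  average (e 1 - e j) = star_summand (e 1 - e j) 0.
Proof.
move=> jr; apply: coset_average1; last exact: lattice_long_sub.
exact/star_summand_periodic/sub_star.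
Qed.

Lemma average_add j : (2 <= j <= r)%N ->
  average (e 1 + e j) = star_summand (e 1 + e j) 0.
Proof.
move=> jr; apply: coset_average1; last exact: lattice_long_add.
exact/star_summand_periodic/add_star.
Qed.

Lemma average_short : average (e 1) =
  2^-1 * (star_summand (e 1) 0 + star_summand (e 1) (e 1 - e 2)).
Proof.
apply: coset_average2; last exact: lattice_short.
- exact/star_summand_periodic/e1_star.
- by apply: (@lattice_sub _ 1) => // [k _|]; [exact: simple_Psi|lia].
- exact: not_lattice_short.
Qed.

Lemma lamC1 : lamC 1 = lamC 2. Proof. by rewrite /lamC lam1. Qed.

(** For the three kinds of roots the dual vector is [k e_1] and the projection of
    [lambda] is [lambda - a e_1], with [(k, a)] equal to [(1, lam 1 - lam j)] for
    [e_1 - e_j], to [(1, lam 1 + lam j)] for [e_1 + e_j], and to [(1/2, lam 1)] for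
    [e_1]. *)
Section DenominatorsAndSummands.
Variables (b : E) (k a : R).
Hypothesis dual_b : star_dual b = k *: e 1.
Hypothesis proj_b : dot (coroot b) lambda * k = a.

Lemma dot_proj v : dot v (star_proj b) = dot v lambda - a * dot v (e 1).
Proof. by rewrite dotBr dual_b !dotZr mulrA proj_b. Qed.

Lemma denominator_short : star_denominator b (e 1) =
  t (e 1) - t b * (2 * k%:C) - twopii * (2 * (lamC 1 - a%:C)).
Proof.
rewrite /star_denominator dot_proj dual_b coroot_e ?(ltnW hr) // dotZr !dotZl.
rewrite dot_ee ?(ltnW hr) // eqxx !mulr1 !(rmorphM, rmorphB, rmorph_nat) -/(lam 1) -/(lamC 1).
ring.
Qed.

Lemma denominator_sub i : (2 <= i <= r)%N -> star_denominator b (e 1 - e i) =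
  t (e 1 - e i) - t b * k%:C - twopii * (lamC 1 - lamC i - a%:C).
Proof.
move=> ir; rewrite /star_denominator dot_proj dual_b coroot_sub; [|lia..].
rewrite dotZr !dotBl !dot_ee; [|lia..].
by rewrite eqxx gtn_eqF ?subr0 ?mulr1 ?rmorphB //; lia.
Qed.

Lemma denominator_add i : (2 <= i <= r)%N -> star_denominator b (e 1 + e i) =
  t (e 1 + e i) - t b * k%:C - twopii * (lamC 1 + lamC i - a%:C).
Proof.
move=> ir; rewrite /star_denominator dot_proj dual_b coroot_add; [|lia..].
rewrite dotZr !dotDl !dot_ee; [|lia..].
by rewrite eqxx gtn_eqF ?addr0 ?mulr1 ?rmorphB ?rmorphD //; lia.
Qed.

Lemma star_summandE q : star_summand b q =
  cexp (twopii * (\sum_(2 <= i < r.+1) (m i)%:~R * (y i)%:C + (dot q lambda)%:C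
                  - a%:C * ((y 1)%:C + (dot q (e 1))%:C)))
  * (t b * cexp (t b * (fractional (k * (y 1 + dot q (e 1))))%:C) / (cexp (t b) - 1)).
Proof.
rewrite /star_summand dot_proj dual_b dotZr !dotDl dot_Y_e1.
by rewrite -dot_Y_lambda -!rmorphD -rmorphM -rmorphB.
Qed.

End DenominatorsAndSummands.

Lemma sum_mC_shift (F : nat -> R[i]) z i j : (2 <= i <= j)%N -> (j <= r)%N ->
  \sum_(i <= k < j) (m k)%:~R * (F k - z)
  = \sum_(i <= k < j) (m k)%:~R * F k - (lamC i - lamC j) * z.
Proof.
move=> ij jr; rewrite -sum_mC // mulr_suml -sumrB.
by apply: eq_bigr => k _; rewrite mulrBr.
Qed.

Variables (tm tp : nat -> R[i]) (t1 : R[i]).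
Hypothesis tmE : forall i, (2 <= i <= r)%N -> t (e 1 - e i) = tm i.
Hypothesis tpE : forall i, (2 <= i <= r)%N -> t (e 1 + e i) = tp i.
Hypothesis t1E : t (e 1) = t1.

Let M j k : R[i] := (m_range m j k)%:~R.
Let mC i : R[i] := (m i)%:~R.
Let yC i : R[i] := (y i)%:C.
Let pii : R[i] := (pi : R)%:C * 'i%C.

Definition sub_value j : R[i] :=
    \prod_(2 <= i < j) (tm i / (tm i - tm j + twopii * M i j.-1))
    * \prod_(j.+1 <= i < r.+1) (tm i / (tm i - tm j - twopii * M j i.-1))
    * \prod_(2 <= i < j.+1)
        (tp i / (tp i - tm j - twopii * (M i j.-1 + 2 * M j r.-1 + mC r)))
    * \prod_(j.+1 <= i < r.+1)
        (tp i / (tp i - tm j - twopii * (M j i.-1 + 2 * M i r.-1 + mC r)))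
    * (t1 / (t1 - 2 * tm j - twopii * (2 * M j r.-1 + mC r)))
    * cexp (twopii * (\sum_(2 <= i < j) mC i * (yC i - yC 1%N)
                      + \sum_(j <= i < r.+1) mC i * yC i))
    * (tm j * cexp (tm j * (fractional (y 1%N))%:C) / (cexp (tm j) - 1)).

Definition add_value j : R[i] :=
    \prod_(2 <= i < j.+1)
        (tm i / (tm i - tp j + twopii * (M i j.-1 + 2 * M j r.-1 + mC r)))
    * \prod_(j.+1 <= i < r.+1)
        (tm i / (tm i - tp j + twopii * (M j i.-1 + 2 * M i r.-1 + mC r)))
    * \prod_(2 <= i < j) (tp i / (tp i - tp j - twopii * M i j.-1))
    * \prod_(j.+1 <= i < r.+1) (tp i / (tp i - tp j + twopii * M j i.-1))
    * (t1 / (t1 - 2 * tp j + twopii * (2 * M j r.-1 + mC r)))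
    * cexp (twopii * (\sum_(2 <= i < j) mC i * (yC i - yC 1%N)
                      + \sum_(j <= i < r) mC i * (yC i - 2 * yC 1%N)
                      + mC r * (yC r - yC 1%N)))
    * (tp j * cexp (tp j * (fractional (y 1%N))%:C) / (cexp (tp j) - 1)).

Definition short_value : R[i] :=
    \prod_(2 <= i < r.+1)
      (tm i / (tm i - 2^-1 * t1 + pii * (2 * M i r.-1 + mC r)))
  * \prod_(2 <= i < r.+1)
      (tp i / (tp i - 2^-1 * t1 - pii * (2 * M i r.-1 + mC r)))
  * (2^-1
     * ( cexp (twopii * (\sum_(2 <= i < r) mC i * (yC i - yC 1%N)
                         + mC r * (yC r - 2^-1 * yC 1%N)))
         * (t1 * cexp (t1 * (fractional (2^-1 * y 1%N))%:C) / (cexp t1 - 1))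
       + cexp (twopii * (\sum_(2 <= i < r) mC i * (yC i - yC 1%N)
                         + mC r * (yC r - 2^-1 * (yC 1%N + 1))))
         * (t1 * cexp (t1 * (fractional (2^-1 * (y 1%N + 1)))%:C) / (cexp t1 - 1)) )).

Lemma sum_my_split j : (2 <= j <= r)%N ->
  \sum_(2 <= i < r.+1) mC i * yC i =
  \sum_(2 <= i < j) mC i * yC i + \sum_(j <= i < r) mC i * yC i + mC r * yC r.
Proof.
move=> jr; rewrite big_nat_recr /=; last by lia.
by rewrite (@big_cat_nat _ _ _ j) //=; lia.
Qed.

(** Once [m_range] and [m_r] are expressed by the coordinates of [lambda], each
    factor is a polynomial identity in these coordinates. *)
Lemma term_sub j : (2 <= j <= r)%N ->
  (\prod_(g <- star_roots | g != e 1 - e j) (t g / star_denominator (e 1 - e j) g))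
  * average (e 1 - e j) = sub_value j.
Proof.
move=> jr; have dual : star_dual (e 1 - e j) = 1 *: e 1 by rewrite star_dual_sub ?scale1r.
have pr : dot (coroot (e 1 - e j)) lambda * 1 = lam 1 - lam j.
  by rewrite coroot_sub ?dotBl ?mulr1 //; lia.
have aE : (lam 1 - lam j)%:C = lamC 1 - lamC j by rewrite rmorphB.
rewrite prod_star_sub // average_sub // (star_summandE dual pr) !dot0l !addr0 mul1r.
rewrite tmE // mulrA /sub_value; congr (_ * _ * _ * _ * _ * _ * _).
- apply: eq_big_nat => i ir; rewrite (denominator_sub dual pr) ?tmE; [|lia..].
  by rewrite aE /M m_rangeC; [congr (_ / _); rewrite rmorph1; ring|lia..].
- apply: eq_big_nat => i ir; rewrite (denominator_sub dual pr) ?tmE; [|lia..].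
  by rewrite aE /M m_rangeC; [congr (_ / _); rewrite rmorph1; ring|lia..].
- apply: eq_big_nat => i ir; rewrite (denominator_add dual pr) ?tmE ?tpE; [|lia..].
  by rewrite aE /M /mC mC_last !m_rangeC; [congr (_ / _); rewrite rmorph1; ring|lia..].
- apply: eq_big_nat => i ir; rewrite (denominator_add dual pr) ?tmE ?tpE; [|lia..].
  by rewrite aE /M /mC mC_last !m_rangeC; [congr (_ / _); rewrite rmorph1; ring|lia..].
- rewrite (denominator_short dual pr) tmE // t1E.
  by rewrite aE /M /mC mC_last !m_rangeC; [congr (_ / _); rewrite rmorph1; ring|lia..].
congr (cexp (_ * _)); rewrite sum_mC_shift; [|lia..].
rewrite (@big_cat_nat _ _ _ j 2 r.+1) /=; [|lia..].
by rewrite aE lamC1; ring.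
Qed.

Lemma term_add j : (2 <= j <= r)%N ->
  (\prod_(g <- star_roots | g != e 1 + e j) (t g / star_denominator (e 1 + e j) g))
  * average (e 1 + e j) = add_value j.
Proof.
move=> jr; have dual : star_dual (e 1 + e j) = 1 *: e 1 by rewrite star_dual_add ?scale1r.
have pr : dot (coroot (e 1 + e j)) lambda * 1 = lam 1 + lam j.
  by rewrite coroot_add ?dotDl ?mulr1 //; lia.
have aE : (lam 1 + lam j)%:C = lamC 1 + lamC j by rewrite rmorphD.
rewrite prod_star_add // average_add // (star_summandE dual pr) !dot0l !addr0 mul1r.
rewrite tpE // mulrA /add_value; congr (_ * _ * _ * _ * _ * _ * _).
- apply: eq_big_nat => i ir; rewrite (denominator_sub dual pr) ?tmE ?tpE; [|lia..].
  by rewrite aE /M /mC mC_last !m_rangeC; [congr (_ / _); rewrite rmorph1; ring|lia..].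
- apply: eq_big_nat => i ir; rewrite (denominator_sub dual pr) ?tmE ?tpE; [|lia..].
  by rewrite aE /M /mC mC_last !m_rangeC; [congr (_ / _); rewrite rmorph1; ring|lia..].
- apply: eq_big_nat => i ir; rewrite (denominator_add dual pr) ?tpE; [|lia..].
  by rewrite aE /M m_rangeC; [congr (_ / _); rewrite rmorph1; ring|lia..].
- apply: eq_big_nat => i ir; rewrite (denominator_add dual pr) ?tpE; [|lia..].
  by rewrite aE /M m_rangeC; [congr (_ / _); rewrite rmorph1; ring|lia..].
- rewrite (denominator_short dual pr) tpE // t1E.
  by rewrite aE /M /mC mC_last !m_rangeC; [congr (_ / _); rewrite rmorph1; ring|lia..].
congr (cexp (_ * _)); rewrite !sum_mC_shift; [|lia..].
by rewrite (sum_my_split jr) aE lamC1 /mC mC_last; ring.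
Qed.

Lemma term_short :
  (\prod_(g <- star_roots | g != e 1) (t g / star_denominator (e 1) g)) * average (e 1) = short_value.
Proof.
have pr : dot (coroot (e 1)) lambda * 2^-1 = lam 1.
  by rewrite coroot_e ?(ltnW hr) // dotZl mulrAC divff ?mul1r // pnatr_eq0.
have dual := star_dual_short.
have half : (2^-1 : R)%:C = 2^-1 :> R[i] by rewrite fmorphV rmorph_nat.
have twopii_pii : twopii = 2 * pii by rewrite mulrA.
have two0 : (2 : R[i]) != 0 by rewrite pnatr_eq0.
rewrite prod_star_short average_short !(star_summandE dual pr) !dot0l !addr0 t1E.
rewrite /short_value; congr (_ * _ * (_ * (_ * _ + _ * _))).
- apply: eq_big_nat => i ir; rewrite (denominator_sub dual pr) ?tmE ?t1E; [|lia..].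
  rewrite half /M /mC mC_last !m_rangeC; [congr (_ / _)|lia..].
  by rewrite -/(lamC 1) twopii_pii; move: pii => p; ring.
- apply: eq_big_nat => i ir; rewrite (denominator_add dual pr) ?tpE ?t1E; [|lia..].
  rewrite half /M /mC mC_last !m_rangeC; [congr (_ / _)|lia..].
  by rewrite -/(lamC 1) twopii_pii; move: pii => p; ring.
- congr (cexp (_ * _)); rewrite sum_mC_shift; [|lia..].
  rewrite (@sum_my_split r) ?[\sum_(r <= i < r) _]big_geq //; last by lia.
  by rewrite -/(lamC 1) lamC1 /mC mC_last; field.
- have m2r : (m_range m 2 r.-1)%:~R \is a @Num.int R by exact: intr_int.
  (* The two exponents for the coset of [e_1 - e_2] differ by the integer
     [m_2 + ... + m_(r-1)], which has no effect after exponentiation. *)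
  transitivity (cexp (twopii * (\sum_(2 <= i < r.+1) (m i)%:~R * (y i)%:C
      + (dot (e 1 - e 2) lambda)%:C - (lam 1)%:C * ((y 1)%:C + (dot (e 1 - e 2) (e 1))%:C)))
      * cexp (twopii * ((m_range m 2 r.-1)%:~R)%:C)).
    by rewrite (cexp_twopii_int m2r) mulr1.
  rewrite -cexpD -mulrDr; congr (cexp (_ * _)).
  rewrite sum_mC_shift; [|lia..].
  rewrite (@sum_my_split r) ?[\sum_(r <= i < r) _]big_geq //; last by lia.
  rewrite !dotBl !dot_ee; [|lia..].
  rewrite rmorph_int m_rangeC; [|lia..].
  rewrite (_ : dot (e 1) lambda - dot (e 2) lambda = 0); last first.
    by apply/eqP; rewrite subr_eq0; apply/eqP/lam1.
  by rewrite -/(lamC 1) lamC1 /mC mC_last /= subr0 rmorph1 rmorph0; field.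
by rewrite !dotBl !dot_ee /= ?subr0 //; lia.
Qed.

Lemma generating_function_B :
  generating_function (B_roots R r) Pos simple (B_I r) phi t Y lambda
  = \sum_(2 <= j < r.+1) sub_value j + \sum_(2 <= j < r.+1) add_value j
    + short_value.
Proof.
rewrite generating_function_star [LHS]sum_star_roots.
congr (_ + _ + _); last exact: term_short.
  by apply: eq_big_nat => j jr; apply: term_sub.
by apply: eq_big_nat => j jr; apply: term_add.
Qed.

End GeneratingFunctionB.

End TypeB.

End GeneratingFunctionOfTypeB.

Theorem mainTheorem1 (R : realType) (r : nat) (hr : (2 <= r)%N)
    (phi : 'rV[R]_r)
    (hphi : generic_vector (B_roots R r) phi)
    (hphi1 : 0 < dot phi (fundamental_weight (@B_simple_root R r)
                                             (Ordinal (ltnW hr))))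
    (y : nat -> R) (m : nat -> int) (t : 'rV[R]_r -> R[i]) :
  let Y : 'rV[R]_r := \sum_(k < r) y k.+1 *: B_simple_coroot R k in
  let lambda : 'rV[R]_r := \sum_(k in B_I r)
                  (m k.+1)%:~R *: fundamental_weight (@B_simple_root R r) k in
  let t1 := t (B_root (2 *: B_e r 1)) in
  let tm i := t (B_root (B_e r 1 - B_e r i)) in
  let tp i := t (B_root (B_e r 1 + B_e r i)) in
  let M j k : R[i] := (m_range m j k)%:~R in
  let mC i : R[i] := (m i)%:~R in
  let yC i : R[i] := (y i)%:C in
  let pii : R[i] := (pi : R)%:C * 'i%C in
  generating_function_regular (B_roots R r) (B_positive_roots R r)
    (@B_simple_root R r) (B_I r) t lambda ->
  generating_function (B_roots R r) (B_positive_roots R r)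
    (@B_simple_root R r) (B_I r) phi t Y lambda
  =
  \sum_(2 <= j < r.+1)
    ( \prod_(2 <= i < j) (tm i / (tm i - tm j + twopii * M i j.-1))
    * \prod_(j.+1 <= i < r.+1) (tm i / (tm i - tm j - twopii * M j i.-1))
    * \prod_(2 <= i < j.+1)
        (tp i / (tp i - tm j - twopii * (M i j.-1 + 2 * M j r.-1 + mC r)))
    * \prod_(j.+1 <= i < r.+1)
        (tp i / (tp i - tm j - twopii * (M j i.-1 + 2 * M i r.-1 + mC r)))
    * (t1 / (t1 - 2 * tm j - twopii * (2 * M j r.-1 + mC r)))
    * cexp (twopii * (\sum_(2 <= i < j) mC i * (yC i - yC 1%N)
                      + \sum_(j <= i < r.+1) mC i * yC i))
    * (tm j * cexp (tm j * (fractional (y 1%N))%:C) / (cexp (tm j) - 1)) )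
  +
  \sum_(2 <= j < r.+1)
    ( \prod_(2 <= i < j.+1)
        (tm i / (tm i - tp j + twopii * (M i j.-1 + 2 * M j r.-1 + mC r)))
    * \prod_(j.+1 <= i < r.+1)
        (tm i / (tm i - tp j + twopii * (M j i.-1 + 2 * M i r.-1 + mC r)))
    * \prod_(2 <= i < j) (tp i / (tp i - tp j - twopii * M i j.-1))
    * \prod_(j.+1 <= i < r.+1) (tp i / (tp i - tp j + twopii * M j i.-1))
    * (t1 / (t1 - 2 * tp j + twopii * (2 * M j r.-1 + mC r)))
    * cexp (twopii * (\sum_(2 <= i < j) mC i * (yC i - yC 1%N)
                      + \sum_(j <= i < r) mC i * (yC i - 2 * yC 1%N)
                      + mC r * (yC r - yC 1%N)))
    * (tp j * cexp (tp j * (fractional (y 1%N))%:C) / (cexp (tp j) - 1)) )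
  +
  \prod_(2 <= i < r.+1)
      (tm i / (tm i - 2^-1 * t1 + pii * (2 * M i r.-1 + mC r)))
  * \prod_(2 <= i < r.+1)
      (tp i / (tp i - 2^-1 * t1 - pii * (2 * M i r.-1 + mC r)))
  * (2^-1
     * ( cexp (twopii * (\sum_(2 <= i < r) mC i * (yC i - yC 1%N)
                         + mC r * (yC r - 2^-1 * yC 1%N)))
         * (t1 * cexp (t1 * (fractional (2^-1 * y 1%N))%:C) / (cexp t1 - 1))
       + cexp (twopii * (\sum_(2 <= i < r) mC i * (yC i - yC 1%N)
                         + mC r * (yC r - 2^-1 * (yC 1%N + 1))))
         * (t1 * cexp (t1 * (fractional (2^-1 * (y 1%N + 1)))%:C) / (cexp t1 - 1)) )).

Proof.
move=> Y lambda t1 tm tp M mC yC pii _.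
have one_le : (0 < 1 <= r)%N by exact: ltnW.
apply: (generating_function_B hr).
- by rewrite -(fundamental_weight1 R hr).
- by move=> i /andP[i2 ir]; rewrite /tm /B_root coroot_sub // ?ir ?ltn_eqF // (ltnW i2).
- by move=> i /andP[i2 ir]; rewrite /tp /B_root coroot_add // ?ir ?ltn_eqF // (ltnW i2).
- by rewrite /t1 /B_root coroot_short.
Qed.
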